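(* The adjoint representation of any compact, semisimple Lie algebra is the holonomy algebra of a certain $3$-form with constant coefficients in euclidean space. That is: let $\mathfrak{g}$ be a compact semisimple Lie algebra of dimension $n$, equipped with an $\mathrm{ad}$-invariant inner product $\langle\cdot,\cdot\rangle$ (so $\langle[X,Y],Z\rangle+\langle Y,[X,Z]\rangle=0$) and regarded as the euclidean space $\mathbb{R}^n=\mathfrak{g}$. Then there exists a $3$-form $\mathrm{T}\in\Lambda^3(\mathfrak{g})$ whose infinitesimal holonomy algebra $\mathfrak{h}_{\mathrm{T}}^*\subset\mathfrak{so}(\mathfrak{g})=\mathfrak{so}(n)$ is the image $\mathrm{ad}(\mathfrak{g})$ of the adjoint representation.
   Context: For a euclidean space $\mathbb{R}^n$, $\mathrm{Cl}(\mathbb{R}^n)$ is the Clifford algebra with $X\cdot X=-\|X\|^2$, identified as a vector space with $\Lambda^*(\mathbb{R}^n)$, and $\mathfrak{cl}(\mathbb{R}^n)$ is the Lie algebra with bracket $[\alpha,\beta]=\alpha\cdot\beta-\beta\cdot\alpha$. For a $3$-form $\mathrm{T}$, $\mathfrak{g}_{\mathrm{T}}^*$ is the Lie subalgebra of $\mathfrak{cl}(\mathbb{R}^n)$ generated by the $2$-forms $X\lrcorner\,\mathrm{T}$ (interior product), $X\in\mathbb{R}^n$, and $\mathfrak{h}_{\mathrm{T}}^*:=[\mathfrak{g}_{\mathrm{T}}^*,\mathfrak{g}_{\mathrm{T}}^*]$. The $2$-forms form a Lie subalgebra of $\mathfrak{cl}(\mathbb{R}^n)$ isomorphic to $\mathfrak{so}(n)$,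 acting on $\mathbb{R}^n$ by skew-symmetric endomorphisms (through the commutator in the Clifford algebra); with this identification $\mathfrak{g}_{\mathrm{T}}^*$ and $\mathfrak{h}_{\mathrm{T}}^*$ are regarded as Lie algebras of skew-symmetric endomorphisms of $\mathbb{R}^n$. *)

(* Defs.v *)
From HB Require Import structures.
From mathcomp Require Import all_boot all_order all_algebra.
From mathcomp Require Import boolp classical_sets reals.

Set Implicit Arguments.
Unset Strict Implicit.
Unset Printing Implicit Defensive.

Import Order.TTheory GRing.Theory Num.Theory.
Local Open Scope ring_scope.

(** The exterior algebra of [R^n] with its Clifford product.

    A multivector is given by its coordinates in the basis [e_S], where [S]
    ranges over the subsets of ['I_n] and, for [S = {i1 < ... < ik}],
      [e_S = e_i1 /\ ... /\ e_ik = e_i1 . ... . e_ik]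
    (wedge product and Clifford product of an orthonormal frame agree on
    strictly increasing lists).  This is the usual identification of the vector
    spaces [Cl(R^n)] and [Lambda^*(R^n)]. *)

Definition clifford (R : comNzRingType) (n : nat) := {ffun {set 'I_n} -> R}.

HB.instance Definition _ (R : comNzRingType) (n : nat) :=
  GRing.Zmodule.on (clifford R n).

Section CliffordModule.
Variables (R : comNzRingType) (n : nat).
Implicit Types (k : R) (a : clifford R n).

Definition cl_scale k a : clifford R n := [ffun S => k * a S].

Lemma cl_scaleA k k' a : cl_scale k (cl_scale k' a) = cl_scale (k * k') a.
Proof. by apply/ffunP => S; rewrite !ffunE mulrA. Qed.

Lemma cl_scale1 : left_id 1 cl_scale.
Proof. by move=> a; apply/ffunP => S; rewrite ffunE mul1r. Qed.

Lemma cl_scaleDr : right_distributive cl_scale +%R.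
Proof. by move=> k a b; apply/ffunP => S; rewrite !ffunE mulrDr. Qed.

Lemma cl_scaleDl a : {morph cl_scale^~ a : k k' / k + k'}.
Proof. by move=> k k'; apply/ffunP => S; rewrite !ffunE mulrDl. Qed.

HB.instance Definition _ :=
  GRing.Zmodule_isLmodule.Build R (clifford R n)
    cl_scaleA cl_scale1 cl_scaleDr cl_scaleDl.

End CliffordModule.

Section Clifford.
Variables (R : comNzRingType) (n : nat).
Implicit Types (a b c : clifford R n) (S T U : {set 'I_n}) (v w : 'rV[R]_n).

Definition cl_basis S : clifford R n := [ffun T => (T == S)%:R].

Definition sym_diff S T : {set 'I_n} := ((S :\: T) :|: (T :\: S))%SET.

(* [e_S . e_T = cl_sign S T *: e_(S Delta T)]: sorting contributes a sign for
   each pair [i \in S], [j \in T] with [j < i], and the relation [e_i . e_i = -1]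
   a sign for each pair with [j = i]. *)
Definition cl_sign S T : R :=
  \prod_(i in S) \prod_(j in T) (-1) ^+ (j <= i)%N.

Definition cl_mul a b : clifford R n :=
  \sum_S \sum_T (a S * b T * cl_sign S T) *: cl_basis (sym_diff S T).

Definition cl_one : clifford R n := cl_basis finset.set0.

Definition cl_vec v : clifford R n :=
  \sum_(i < n) v 0 i *: cl_basis (finset.set1 i).

Definition is_form (k : nat) a := forall S, #|S| != k -> a S = 0.

(* [v _| (e_i1 /\ ... /\ e_ik) =
      \sum_l (-1)^(l-1) v_il (e_i1 /\ ... omit e_il ... /\ e_ik)] *)
Definition interior v a : clifford R n :=
  \sum_(S : {set 'I_n}) \sum_(i in S)
    ((-1) ^+ #|[pred j in S | (j < i)%N]| * v 0 i * a S)
      *: cl_basis (S :\ i)%SET.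

Lemma cl_scaleE (k : R) a S : (k *: a) S = k * a S.
Proof. by rewrite ffunE. Qed.

Lemma cl_expand a : a = \sum_S a S *: cl_basis S.
Proof.
apply/ffunP => T; rewrite sum_ffunE (bigD1 T) //= cl_scaleE ffunE eqxx mulr1.
rewrite big1 ?addr0 // => S ST.
by rewrite cl_scaleE ffunE eq_sym (negPf ST) mulr0.
Qed.

Lemma cl_mulDl : left_distributive cl_mul +%R.
Proof.
move=> a b c; rewrite /cl_mul -big_split; apply: eq_bigr => S _ /=.
rewrite -big_split; apply: eq_bigr => T _ /=.
by rewrite ffunE !mulrDl scalerDl.
Qed.

Lemma cl_mulDr : right_distributive cl_mul +%R.
Proof.
move=> a b c; rewrite /cl_mul -big_split; apply: eq_bigr => S _ /=.
rewrite -big_split; apply: eq_bigr => T _ /=.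
by rewrite ffunE !mulrDr mulrDl scalerDl.
Qed.

Lemma cl_mulZl (k : R) a b : cl_mul (k *: a) b = k *: cl_mul a b.
Proof.
rewrite /cl_mul scaler_sumr; apply: eq_bigr => S _ /=.
rewrite scaler_sumr; apply: eq_bigr => T _ /=.
by rewrite cl_scaleE scalerA !mulrA.
Qed.

Lemma cl_mulZr (k : R) a b : cl_mul a (k *: b) = k *: cl_mul a b.
Proof.
rewrite /cl_mul scaler_sumr; apply: eq_bigr => S _ /=.
rewrite scaler_sumr; apply: eq_bigr => T _ /=.
by rewrite cl_scaleE scalerA [a S * _]mulrCA !mulrA.
Qed.

Section Bilinear.
Variables (m : clifford R n -> clifford R n -> clifford R n)
  (mDl : left_distributive m +%R) (mDr : right_distributive m +%R)
  (mZl : forall (k : R) a b, m (k *: a) b = k *: m a b)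
  (mZr : forall (k : R) a b, m a (k *: b) = k *: m a b).

Lemma bilin_suml (I : finType) (P : pred I) (F : I -> clifford R n) b :
  m (\sum_(i | P i) F i) b = \sum_(i | P i) m (F i) b.
Proof.
apply: (big_morph (m^~ b)) => [x y|]; first exact: mDl.
by rewrite -(scale0r 0) mZl !scale0r.
Qed.

Lemma bilin_sumr (I : finType) (P : pred I) a (F : I -> clifford R n) :
  m a (\sum_(i | P i) F i) = \sum_(i | P i) m a (F i).
Proof.
apply: (big_morph (m a)) => [x y|]; first exact: mDr.
by rewrite -(scale0r 0) mZr !scale0r.
Qed.

Lemma bilin_assoc :
  (forall S T U, m (cl_basis S) (m (cl_basis T) (cl_basis U)) =
                 m (m (cl_basis S) (cl_basis T)) (cl_basis U)) ->
  associative m.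
Proof.
move=> mA a b c; rewrite [a]cl_expand [b]cl_expand [c]cl_expand.
rewrite !bilin_suml; apply: eq_bigr => S _.
rewrite bilin_sumr [X in _ = m X _]bilin_sumr bilin_suml; apply: eq_bigr => T _.
rewrite !bilin_sumr; apply: eq_bigr => U _.
rewrite !(mZl, mZr) mA !scalerA; congr (_ *: _).
by rewrite mulrC mulrA.
Qed.

End Bilinear.

Lemma cl_mul_basis S T :
  cl_mul (cl_basis S) (cl_basis T) = cl_sign S T *: cl_basis (sym_diff S T).
Proof.
rewrite /cl_mul (bigD1 S) //= [X in _ + X]big1 ?addr0 => [|S' S'S]; last first.
  by rewrite big1 // => T' _; rewrite ffunE (negPf S'S) !mul0r scale0r.
rewrite (bigD1 T) //= [X in _ + X]big1 ?addr0 => [|T' T'T]; last first.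
  by rewrite !ffunE (negPf T'T) mulr0 mul0r scale0r.
by rewrite !ffunE !eqxx !mul1r.
Qed.

Lemma in_sym_diff S T i : (i \in sym_diff S T) = (i \in S) (+) (i \in T).
Proof. by rewrite !inE; case: (i \in S); case: (i \in T). Qed.

Lemma sym_diffA : associative sym_diff.
Proof. by move=> S T U; apply/setP=> i; rewrite !in_sym_diff addbA. Qed.

Lemma prod_sign_sym_diff (f : 'I_n -> R) S T : (forall i, f i * f i = 1) ->
  \prod_(i in sym_diff S T) f i = (\prod_(i in S) f i) * \prod_(i in T) f i.
Proof.
move=> ff; rewrite !(big_mkcond (fun i => i \in _)) /= -big_split /=.
apply: eq_bigr => i _; rewrite in_sym_diff.
by case: (i \in S); case: (i \in T); rewrite ?ff ?mulr1 ?mul1r.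
Qed.

Lemma cl_sign_sym_diffl S T U :
  cl_sign (sym_diff S T) U = cl_sign S U * cl_sign T U.
Proof.
apply: prod_sign_sym_diff => i; rewrite -big_split big1 // => j _ /=.
by rewrite -signr_addb addbb.
Qed.

Lemma cl_sign_sym_diffr S T U :
  cl_sign S (sym_diff T U) = cl_sign S T * cl_sign S U.
Proof.
rewrite /cl_sign -big_split; apply: eq_bigr => i _ /=.
by apply: prod_sign_sym_diff => j; rewrite -signr_addb addbb.
Qed.

Lemma cl_mulA : associative cl_mul.
Proof.
apply: (bilin_assoc cl_mulDl cl_mulDr cl_mulZl cl_mulZr) => S T U.
rewrite !(cl_mul_basis, cl_mulZl, cl_mulZr) !scalerA sym_diffA.
by rewrite cl_sign_sym_diffl cl_sign_sym_diffr mulrC -mulrA.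
Qed.

Lemma cl_mul1 : left_id cl_one cl_mul.
Proof.
move=> a; rewrite {1}[a]cl_expand (bilin_sumr cl_mulDr cl_mulZr).
rewrite [RHS]cl_expand; apply: eq_bigr => S _.
rewrite cl_mulZr cl_mul_basis /cl_sign big_set0 scale1r.
by congr (_ *: cl_basis _); apply/setP => i; rewrite in_sym_diff inE.
Qed.

Lemma cl_mulr1 : right_id cl_one cl_mul.
Proof.
move=> a; rewrite {1}[a]cl_expand (bilin_suml cl_mulDl cl_mulZl).
rewrite [RHS]cl_expand; apply: eq_bigr => S _.
rewrite cl_mulZl cl_mul_basis /cl_sign big1 => [|i _]; last by rewrite big_set0.
rewrite scale1r.
by congr (_ *: cl_basis _); apply/setP => i; rewrite in_sym_diff inE addbF.
Qed.

Lemma cl_one_neq0 : cl_one != 0.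
Proof.
apply/eqP => /ffunP/(_ finset.set0)/eqP.
by rewrite !ffunE eqxx oner_eq0.
Qed.

End Clifford.

HB.instance Definition _ (R : comNzRingType) (n : nat) :=
  GRing.Zmodule_isNzRing.Build (clifford R n)
    (@cl_mulA R n) (@cl_mul1 R n) (@cl_mulr1 R n)
    (@cl_mulDl R n) (@cl_mulDr R n) (@cl_one_neq0 R n).

HB.instance Definition _ (R : comNzRingType) (n : nat) :=
  GRing.Lmodule_isLalgebra.Build R (clifford R n)
    (fun k a b => esym (@cl_mulZl R n k a b)).

HB.instance Definition _ (R : comNzRingType) (n : nat) :=
  GRing.Lalgebra_isAlgebra.Build R (clifford R n)
    (fun k a b => esym (@cl_mulZr R n k a b)).

Definition dotp (R : comNzRingType) (n : nat) (v w : 'rV[R]_n) : R :=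
  \sum_(i < n) v 0 i * w 0 i.

Lemma cl_basis_mul (R : comNzRingType) (n : nat) (S T : {set 'I_n}) :
  cl_basis R S * cl_basis R T = cl_sign R S T *: cl_basis R (sym_diff S T).
Proof. exact: cl_mul_basis. Qed.

Lemma cl_frame_anticomm (R : comNzRingType) (n : nat) (i j : 'I_n) :
  let e k := cl_basis R (finset.set1 k) in
  e i * e j + e j * e i = (- 2 * (i == j)%:R)%:A.
Proof.
rewrite /= !cl_basis_mul /cl_sign !big_set1.
have -> : sym_diff (finset.set1 j) (finset.set1 i)
          = sym_diff (finset.set1 i) (finset.set1 j).
  by apply/setP => k; rewrite !in_sym_diff addbC.
rewrite -scalerDl; have [<-|ij] := eqVneq i j.
  rewrite leqnn mulr1 -opprD; congr (_ *: cl_basis _ _).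
  by apply/setP => k; rewrite in_sym_diff addbb inE.
rewrite mulr0 scale0r; have : (i : nat) != j by [].
by rewrite neq_ltn => /orP[] ij'; rewrite (ltnW ij') leqNgt ij' /= ?addNr ?addrN
  scale0r.
Qed.

(* Polarization of [X . X = - |X|^2]. *)
Lemma cl_vec_anticomm (R : comNzRingType) (n : nat) (v w : 'rV[R]_n) :
  cl_vec v * cl_vec w + cl_vec w * cl_vec v = (- 2 * dotp v w)%:A.
Proof.
rewrite /cl_vec !mulr_suml.
under eq_bigr do rewrite mulr_sumr.
under [X in _ + X]eq_bigr do rewrite mulr_sumr.
rewrite [X in _ + X]exchange_big -big_split /dotp mulr_sumr scaler_suml.
apply: eq_bigr => i _; rewrite -big_split (bigD1 i) //=.
rewrite big1 ?addr0 => [|j ji]; rewrite -!scalerAl -!scalerAr !scalerA.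
  by rewrite [w 0 i * _]mulrC -scalerDr cl_frame_anticomm eqxx scalerA mulr1 mulrC.
rewrite [w 0 j * _]mulrC -scalerDr cl_frame_anticomm eq_sym (negPf ji).
by rewrite mulr0 scale0r scaler0.
Qed.

Definition cl_bracket (R : comNzRingType) (n : nat) (a b : clifford R n) :=
  a * b - b * a.

(* The commutator of a 2-form with a vector is a vector, so a 2-form [a] acts as
   exactly one [F]: this is the identification of the 2-forms with [so(n)]. *)
Definition acts_as (R : fieldType) (n : nat) (a : clifford R n)
    (F : 'End('rV[R]_n)) :=
  forall v, cl_vec (F v) = cl_bracket a (cl_vec v).

Local Open Scope classical_set_scope.

Section Lie.
Variables (R : comNzRingType) (V : lmodType R) (br : V -> V -> V).
Implicit Types A B I : set V.

Definition is_subspace A :=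
  A 0 /\ forall (k : R) x y, A x -> A y -> A (k *: x + y).

Definition is_lie_subalgebra A :=
  is_subspace A /\ forall x y, A x -> A y -> A (br x y).

Definition is_ideal I :=
  is_subspace I /\ forall x y, I y -> I (br x y).

Definition lie_generated A : set V := smallest is_lie_subalgebra A.

Definition lie_brackets A B : set V :=
  smallest is_subspace [set br x y | x in A & y in B].

Definition derived_algebra A : set V := lie_brackets A A.

Definition is_solvable I := exists k : nat, iter k derived_algebra I = [set 0].

Definition is_semisimple :=
  forall I, is_ideal I -> is_solvable I -> I = [set 0].

End Lie.

Definition is_lie_bracket (R : comNzRingType) (V : lmodType R)
    (br : {bilinear V -> V -> V}) :=
  (forall x, br x x = 0) /\
  (forall x y z, br x (br y z) + br y (br z x) + br z (br x y) = 0).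

Definition ad_invariant (R : realType) (V : lmodType R)
    (br : V -> V -> V) (ip : V -> V -> R) :=
  forall x y z, ip (br x y) z + ip y (br x z) = 0.

(* Equivalently, [V] is the Lie algebra of a compact Lie group. *)
Definition is_compact_lie (R : realType) (V : lmodType R) (br : V -> V -> V) :=
  exists ip : {dot V for idfun}, ad_invariant br ip.

(* [g_T^*] and [h_T^*], as subsets of the Clifford algebra. *)
Definition holonomy_g (R : comNzRingType) (n : nat) (T : clifford R n) :
    set (clifford R n) :=
  lie_generated (@cl_bracket R n) (range (fun v : 'rV[R]_n => interior v T)).

Definition holonomy_h (R : comNzRingType) (n : nat) (T : clifford R n) :
    set (clifford R n) :=
  derived_algebra (@cl_bracket R n) (holonomy_g T).

(* Main.v *)
From HB Require Import structures.
Require Import Defs.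
From mathcomp Require Import all_boot all_order all_algebra ring.
From mathcomp Require Import boolp classical_sets reals.

Set Implicit Arguments.
Unset Strict Implicit.
Unset Printing Implicit Defensive.

Import Order.TTheory GRing.Theory Num.Theory.
Local Open Scope ring_scope.
Local Open Scope classical_set_scope.

(** The 3-form is, up to scale, the Cartan form [<[x, y], z>] of the Lie
    algebra.

    A skew endomorphism [F] of [R^n] is the Clifford commutator with the 2-form
    [spin F = 1/4 sum_i e_i . F e_i] (lemma [spin_bracket_vec]), and [spin]
    turns commutators of endomorphisms into Clifford brackets (lemma
    [spin_bracket]).  Take a linear family [v |-> A v] of skew endomorphisms
    with [A v v = 0], so that [<A u v, w>] is totally antisymmetric, and set
    [T = 1/12 sum_ij e_i . e_j . A e_i e_j].  This is a 3-form, and its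
    contraction with [v] is exactly [spin (A v)] (lemma
    [interior_three_form]).  The computation needs no choice of indices
    [i < j < k]: on forms of odd degree, contraction with [v] is -1/2 times the
    anticommutator with [v] (lemma [interior_odd]), and the anticommutator of
    a vector with a triple product of vectors is expanded by the Clifford
    relation.

    Apply this to the adjoint representation, read in the orthonormal frame.
    The Jacobi identity says that [A] is closed under commutators, so the
    2-forms [spin (A v)] already form a Lie algebra: it is [g_T^*], isomorphic
    to [ad g].  It remains to see that passing to the derived algebra [h_T^*]
    loses nothing, that is, that [g] is perfect.  The Casimir operator
    [sum_i (ad e_i)^2] is negative semidefinite, since the [ad e_i] are skew,
    and its kernel is the centre of [g].  The centre is an abelian ideal, hence
    zero by semisimplicity.  So the Casimir operator is invertible, and every
    vector is a sum of brackets [[e_i, [e_i, w]]] (lemma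
    [skew_square_sum_onto]). *)

(** * Vectors, contraction and the Clifford relation *)

Section CliffordVectors.
Variables (R : comNzRingType) (n : nat).
Implicit Types (i j : 'I_n) (v w : 'rV[R]_n) (a : clifford R n) (S : {set 'I_n}).

Lemma cl_vec_is_linear : linear (@cl_vec R n).
Proof.
move=> k v w; rewrite /cl_vec scaler_sumr -big_split; apply: eq_bigr => i _ /=.
by rewrite !mxE scalerDl scalerA.
Qed.

HB.instance Definition _ :=
  GRing.isLinear.Build R 'rV[R]_n (clifford R n) *:%R (@cl_vec R n)
    cl_vec_is_linear.

Lemma cl_vec_coord v i : cl_vec v (finset.set1 i) = v 0 i.
Proof.
rewrite /cl_vec sum_ffunE (bigD1 i) //= cl_scaleE ffunE eqxx mulr1.
rewrite big1 ?addr0 // => j ji; rewrite cl_scaleE ffunE.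
by rewrite (inj_eq finset.set1_inj) eq_sym (negPf ji) mulr0.
Qed.

Lemma cl_vec_inj : injective (@cl_vec R n).
Proof.
by move=> v w vw; apply/rowP => i; rewrite -!cl_vec_coord vw.
Qed.

Lemma cl_vec_delta i : cl_vec (delta_mx 0 i) = cl_basis R (finset.set1 i).
Proof.
rewrite /cl_vec (bigD1 i) //= mxE !eqxx scale1r big1 ?addr0 // => j ji.
by rewrite mxE eqxx (negPf ji) scale0r.
Qed.

Lemma dotpC v w : dotp v w = dotp w v.
Proof. by apply: eq_bigr => i _; rewrite mulrC. Qed.

Lemma dotp_delta v i : dotp v (delta_mx 0 i) = v 0 i.
Proof.
rewrite /dotp (bigD1 i) //= mxE !eqxx mulr1 big1 ?addr0 // => j ji.
by rewrite mxE eqxx (negPf ji) mulr0.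
Qed.

Lemma sum_dotp_delta v : v = \sum_i dotp v (delta_mx 0 i) *: delta_mx 0 i.
Proof.
by rewrite {1}[v]row_sum_delta; apply: eq_bigr => i _; rewrite dotp_delta.
Qed.

(** Each [j \in S] with [j != i] contributes a sign to exactly one of the two
    factors, and [j = i] contributes one to both.  For [i \notin S] the two
    signs thus differ by [(-1) ^ #|S| = -1]; for [i \in S] they agree. *)
Lemma sum_sign_basis i S : odd #|S| ->
  cl_sign R (finset.set1 i) S + cl_sign R S (finset.set1 i) =
  if i \in S then - (2 * (-1) ^+ #|[pred j in S | (j < i)%N]|) else 0.
Proof.
move=> oddS; rewrite /cl_sign big_set1.
under [X in _ + X]eq_bigr do rewrite big_set1.
rewrite !prodrXr.
set p := (\sum_(j in S) (j <= i)%N)%N; set q := (\sum_(j in S) (i <= j)%N)%N.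
set m := #|_|.
have S1 : (\sum_(j in S) (j == i) = (i \in S))%N.
  have [iS|iS] := boolP (i \in S); last first.
    by rewrite big1 // => j jS; case: eqP iS => // <-; rewrite jS.
  by rewrite (bigD1 i) //= eqxx big1 // => j /andP[_ /negPf->].
have pE : p = (m + (i \in S))%N.
  rewrite -S1 /m -sum1_card (eq_bigl (fun j => (j \in S) && (j < i)%N)) //.
  rewrite big_mkcondr -big_split; apply: eq_bigr => j _ /=.
  by rewrite leq_eqVlt -(inj_eq val_inj) /=; case: ltngtP.
have pqE : (p + q = #|S| + (i \in S))%N.
  rewrite -S1 -sum1_card -!big_split; apply: eq_bigr => j _ /=.
  by rewrite -(inj_eq val_inj) /=; case: ltngtP.
have /(congr1 odd) := pqE; rewrite !oddD oddS addTb => opq.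
rewrite -signr_odd -[in X in _ + X]signr_odd -[in RHS]signr_odd.
have /(congr1 odd) := pE; rewrite oddD.
case: ifP opq => _; rewrite ?addbT ?addbF.
  by case: (odd p); case: (odd q) => //=; case: (odd m) => //= _ _;
   rewrite ?expr0 ?expr1 ?mulr1 ?mulrN1 ?opprK ?mulrN // -?opprD -mulr2n.
by case: (odd p); case: (odd q) => //= _ _; rewrite ?expr0 ?expr1 ?addNr ?subrr.
Qed.

(** In the Clifford algebra [v . a = v /\ a - v _| a].  When [a] is odd,
    [a . v = - v /\ a - v _| a], so the wedge products cancel in the
    anticommutator. *)
Lemma interior_odd v a : (forall S, ~~ odd #|S| -> a S = 0) ->
  interior v a *+ 2 = - (cl_vec v * a + a * cl_vec v).
Proof.
move=> a_odd; rewrite {2 3}[a]cl_expand mulr_sumr mulr_suml -big_split /=.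
rewrite /interior -sumrMnl -sumrN; apply: eq_bigr => S _.
have [oddS|/a_odd->] := boolP (odd #|S|); last first.
  rewrite scale0r mulr0 mul0r addr0 oppr0 big1 ?mul0rn // => i _.
  by rewrite mulr0 scale0r.
rewrite /cl_vec mulr_suml mulr_sumr -big_split -sumrN -sumrMnl /=.
rewrite big_mkcond; apply: eq_bigr => i _.
have -> : v 0 i *: cl_basis R (finset.set1 i) * (a S *: cl_basis R S) +
    a S *: cl_basis R S * (v 0 i *: cl_basis R (finset.set1 i)) =
  (v 0 i * a S * (cl_sign R (finset.set1 i) S + cl_sign R S (finset.set1 i)))
    *: cl_basis R (sym_diff S (finset.set1 i)).
  rewrite -!scalerAl -!scalerAr !cl_basis_mul !scalerA.
  have -> : sym_diff (finset.set1 i) S = sym_diff S (finset.set1 i).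
    by apply/setP => k; rewrite !in_sym_diff addbC.
  by rewrite -scalerDl mulrDr [a S * _]mulrC.
rewrite sum_sign_basis //; case: ifP => iS; last by rewrite mulr0 scale0r oppr0.
have -> : sym_diff S (finset.set1 i) = (S :\ i)%SET.
  by apply/setP => k; rewrite in_sym_diff !inE; case: eqP => [->|_];
    rewrite ?iS ?addbF.
rewrite mulrN scaleNr opprK -scaler_nat scalerA; congr (_ *: _); ring.
Qed.

End CliffordVectors.

(** * Skew endomorphisms as 2-forms *)

Section Skew.
Variables (R : comNzRingType) (n : nat).
Implicit Types (v w : 'rV[R]_n) (a b c d : clifford R n).

Definition skew (F : 'rV[R]_n -> 'rV[R]_n) :=
  forall v w, dotp (F v) w = - dotp v (F w).

Local Notation e i := (cl_vec (delta_mx 0 i : 'rV[R]_n)).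

(** The tensor [sum_i F e_i (x) G e_i] does not depend on the orthonormal frame,
    so [F] may be moved to the other factor as its adjoint, [- F]. *)
Lemma sum_skew_mul (F G : {linear 'rV[R]_n -> 'rV[R]_n}) : skew F ->
  \sum_i cl_vec (F (delta_mx 0 i)) * cl_vec (G (delta_mx 0 i)) =
  - \sum_i e i * cl_vec (G (F (delta_mx 0 i))).
Proof.
move=> skF; under eq_bigr => i _ do
  rewrite [F _]sum_dotp_delta linear_sum mulr_suml.
rewrite exchange_big -sumrN; apply: eq_bigr => k _ /=.
rewrite [F (delta_mx 0 k)]sum_dotp_delta (linear_sum G).
rewrite (linear_sum (@cl_vec R n)) mulr_sumr -sumrN.
apply: eq_bigr => i _; rewrite !linearZ -scalerAl -scalerAr -scaleNr /=.
by congr (_ *: _); rewrite skF dotpC.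
Qed.

Lemma cl_bracketMr a b c :
  cl_bracket a (b * c) = cl_bracket a b * c + b * cl_bracket a c.
Proof. by rewrite /cl_bracket mulrBl mulrBr !mulrA addrA subrK. Qed.

(** The commutator of a product of two vectors with a third vector reduces to
    anticommutators, which the Clifford relation evaluates to scalars. *)
Lemma cl_bracket_anticomm a b c :
  cl_bracket (a * b) c = a * (b * c + c * b) - (a * c + c * a) * b.
Proof. by rewrite /cl_bracket mulrDr mulrDl !mulrA opprD addrA addrK. Qed.

Lemma anticomm_mul3 d a b c :
  d * (a * b * c) + a * b * c * d =
  (d * a + a * d) * b * c - a * (d * b + b * d) * c + a * b * (d * c + c * d).
Proof.
rewrite !mulrDr !mulrDl !mulrA opprD !addrA.
by rewrite addrK addrNK.
Qed.

End Skew.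

Section Spin.
Variables (R : numFieldType) (n : nat).
Implicit Types (v w : 'rV[R]_n) (F G : 'End('rV[R]_n)).

Local Notation e i := (cl_vec (delta_mx 0 i : 'rV[R]_n)).

Definition spin F : clifford R n :=
  4^-1 *: \sum_i e i * cl_vec (F (delta_mx 0 i)).

Lemma spin_is_linear : linear spin.
Proof.
move=> k F G; rewrite /spin scalerA mulrC -scalerA -scalerDr; congr (_ *: _).
rewrite scaler_sumr -big_split; apply: eq_bigr => i _ /=.
by rewrite add_lfunE scale_lfunE linearP mulrDr -scalerAr.
Qed.

HB.instance Definition _ :=
  GRing.isLinear.Build R 'End('rV[R]_n) (clifford R n) *:%R spin spin_is_linear.

(** With [v_i = <v, e_i>], the [i]-th summand of [[4 spin F, v]] is
    [2 <F v, e_i> e_i + 2 v_i F e_i]; each half sums to [2 F v], which is where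
    the factor 1/4 comes from. *)
Lemma spin_bracket_vec F v : skew F ->
  cl_bracket (spin F) (cl_vec v) = cl_vec (F v).
Proof.
move=> skF; rewrite /cl_bracket /spin -scalerAl -scalerAr -scalerBr.
have -> : cl_vec (F v) = 4^-1 *: (4%:R *: cl_vec (F v)).
  by rewrite scalerA mulVf ?scale1r ?pnatr_eq0.
congr (_ *: _); rewrite mulr_suml mulr_sumr -sumrB.
transitivity (\sum_i (2 *: (dotp (F v) (delta_mx 0 i) *: e i) +
                       2 *: (dotp v (delta_mx 0 i) *: cl_vec (F (delta_mx 0 i))))).
  apply: eq_bigr => i _; rewrite -/(cl_bracket _ _) cl_bracket_anticomm.
  rewrite !cl_vec_anticomm mulr_algr mulr_algl skF dotpC !scalerA.
  rewrite [dotp (delta_mx 0 i) v]dotpC.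
  by rewrite mulrNN mulNr scaleNr opprK.
rewrite big_split /= -!scaler_sumr.
under eq_bigr do rewrite -linearZ.
under [X in _ + _ *: X]eq_bigr do rewrite -!linearZ.
by rewrite -!linear_sum -!sum_dotp_delta -scalerDl -natrD.
Qed.

(** Bracketing with [spin F] is a derivation that acts on vectors as [F], so it
    sends [e_i . G e_i] to [F e_i . G e_i + e_i . F (G e_i)]; in the sum over
    [i] the first term becomes [- e_i . G (F e_i)] by skewness. *)
Lemma spin_bracket F G : skew F ->
  cl_bracket (spin F) (spin G) = spin ((F \o G) - (G \o F))%VF.
Proof.
move=> skF; move: (spin F) (fun v => spin_bracket_vec v skF) => s sE.
rewrite [spin G]/spin /cl_bracket -scalerAl -scalerAr -scalerBr.
rewrite [RHS]/spin; congr (_ *: _); rewrite mulr_suml mulr_sumr -sumrB.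
under eq_bigr => i _ do
  rewrite -/(cl_bracket _ _) cl_bracketMr !sE.
rewrite big_split /= sum_skew_mul // -sumrN -big_split; apply: eq_bigr => i _ /=.
by rewrite add_lfunE opp_lfunE !comp_lfunE linearB mulrBr addrC.
Qed.

End Spin.

(** * Sums of squares of skew endomorphisms *)

Lemma dotp_is_scalar (R : comNzRingType) n (v : 'rV[R]_n) : scalar (dotp v).
Proof.
move=> k x y; rewrite /dotp mulr_sumr -big_split; apply: eq_bigr => i _ /=.
by rewrite !mxE mulrDr mulrCA.
Qed.

HB.instance Definition _ (R : comNzRingType) n (v : 'rV[R]_n) :=
  GRing.isLinear.Build R 'rV[R]_n R *%R (dotp v) (dotp_is_scalar v).

Lemma dotp_eq0 (R : realDomainType) n (v : 'rV[R]_n) : dotp v v = 0 -> v = 0.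
Proof.
move/eqP; rewrite /dotp psumr_eq0 => [/allP v0|i _]; last exact: sqr_ge0.
apply/rowP => i; rewrite mxE; apply/eqP.
by have := v0 i (mem_index_enum i); rewrite mulf_eq0 orbb.
Qed.

(** The operator [K = sum_i (A i)^2] satisfies [<K w, w> = - sum_i |A i w|^2],
    so its kernel is the common kernel of the [A i]. *)
Lemma skew_square_sum_onto (R : realFieldType) n (I : finType)
    (A : I -> 'End('rV[R]_n)) :
  (forall i, skew (A i)) -> (forall v, (forall i, A i v = 0) -> v = 0) ->
  forall v, exists w, v = \sum_i A i (A i w).
Proof.
move=> skA A0 v; pose K := (\sum_i (A i \o A i))%VF.
have KE w : K w = \sum_i A i (A i w).
  by rewrite sum_lfunE; apply: eq_bigr => i _; rewrite comp_lfunE.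
have Kinj : lker K == 0%VS.
  rewrite -subv0; apply/subvP => w; rewrite memv_ker memv0 => /eqP Kw0.
  apply/eqP/A0 => i; apply: dotp_eq0.
  have /eqP : \sum_j dotp (A j w) (A j w) = 0.
    transitivity (- dotp w (K w)); last by rewrite Kw0 linear0 oppr0.
    rewrite KE linear_sum -sumrN; apply: eq_bigr => j _.
    by rewrite skA.
  rewrite psumr_eq0 => [/allP/(_ i (mem_index_enum i))/eqP //|j _].
  by apply: sumr_ge0 => k _; apply: sqr_ge0.
by exists ((K^-1)%VF v); rewrite -KE lker0_lfunVK.
Qed.

(** * The 3-form of an alternating family of skew endomorphisms *)

Section ThreeForm.
Variables (R : numFieldType) (n : nat) (A : {linear 'rV[R]_n -> 'End('rV[R]_n)}).
Hypotheses (A_skew : forall v, skew (A v)) (A_alt : forall v, A v v = 0).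
Implicit Types (v w : 'rV[R]_n) (i j k : 'I_n).

Local Notation b i := (delta_mx 0 i : 'rV[R]_n).
Local Notation e i := (cl_vec (b i)).

(** The sum over all [i], [j] counts each [e_i . e_j . e_k] with [i < j < k] six
    times, so this is half of [sum_(i < j < k) <A e_i e_j, e_k> e_i . e_j . e_k];
    the half makes the contraction with [v] equal to [spin (A v)]. *)
Definition three_form : clifford R n :=
  12^-1 *: \sum_i \sum_j e i * e j * cl_vec (A (b i) (b j)).

Lemma alternating_antisym v w : A v w = - A w v.
Proof.
have := A_alt (v + w); rewrite (linearD A) add_lfunE.
rewrite (linearD (A v)) (linearD (A w)) /= !A_alt add0r addr0.
by move/eqP; rewrite addr_eq0 => /eqP.
Qed.

(** A product [e_i . e_j . e_k] has degree 3 unless two indices agree, and then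
    its coefficient [<A e_i e_j, e_k>] vanishes by total antisymmetry. *)
Lemma is_form3_three_form : is_form 3 three_form.
Proof.
move=> S S3; rewrite /three_form cl_scaleE sum_ffunE big1 ?mulr0 // => i _.
rewrite sum_ffunE big1 // => j _; rewrite {3}/cl_vec mulr_sumr sum_ffunE.
rewrite big1 // => k _; rewrite -scalerAr !cl_vec_delta cl_basis_mul -scalerAl.
rewrite cl_basis_mul !cl_scaleE ffunE; case: eqP => [SE|_]; last by rewrite !mulr0.
have AE : A (b i) (b j) 0 k = dotp (A (b i) (b j)) (b k) by rewrite dotp_delta.
rewrite AE.
have [ij|ij] := eqVneq i j; first by rewrite ij A_alt dotpC linear0 mul0r.
have [ik|ik] := eqVneq i k.
  by rewrite ik A_skew A_alt linear0 oppr0 mul0r.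
have [jk|jk] := eqVneq j k.
  rewrite jk alternating_antisym dotpC linearN /= dotpC A_skew A_alt.
  by rewrite linear0 !oppr0 mul0r.
case/eqP: S3; have -> : S = (i |: [set j; k])%SET.
  apply/setP => l; rewrite SE !in_sym_diff !inE.
  have [->|_] := eqVneq l i; first by rewrite (negPf ij) (negPf ik).
  by have [->|_] := eqVneq l j; first by rewrite (negPf jk).
by rewrite cardsU1 cards2 !inE negb_or ij ik jk.
Qed.

(** Contracting any of the three factors of the antisymmetric sum gives the same
    2-form [s = 4 spin (A v)]: the three cases are [sumX], [sumY] and [sumZ]. *)
Lemma interior_three_form v : interior v three_form = spin (A v).
Proof.
have two0 : 2 != 0 :> R by rewrite pnatr_eq0.
apply: (scalerI two0); rewrite scaler_nat interior_odd; last first.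
  by move=> S; apply: contraNeq => /eqP; have := @is_form3_three_form S;
    case: (#|S| =P 3) => [->|_ ->].
rewrite /three_form -scalerAr -scalerAl -scalerDr mulr_sumr mulr_suml -big_split.
pose s := \sum_i e i * cl_vec (A v (b i)).
suff -> : \sum_i (cl_vec v * (\sum_j e i * e j * cl_vec (A (b i) (b j))) +
    (\sum_j e i * e j * cl_vec (A (b i) (b j))) * cl_vec v) = - 6 *: s.
  rewrite /spin -/s !scalerA -scaleNr; congr (_ *: _); by field; rewrite ?pnatr_eq0.
transitivity (\sum_i \sum_j ((- 2) *: (
    e j * cl_vec (dotp v (b i) *: A (b i) (b j))
    - e i * cl_vec (A (b i) (dotp v (b j) *: b j))
    + e i * cl_vec (dotp v (A (b i) (b j)) *: b j)))).
  apply: eq_bigr => i _; rewrite mulr_sumr mulr_suml -big_split.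
  apply: eq_bigr => j _ /=; rewrite anticomm_mul3 !cl_vec_anticomm.
  rewrite mulr_algr mulr_algl mulr_algr.
  by rewrite !linearZ /= -!scalerAr -!scalerAl scalerDr scalerBr !scalerA.
have sumX : \sum_i \sum_j e j * cl_vec (dotp v (b i) *: A (b i) (b j)) = s.
  rewrite exchange_big; apply: eq_bigr => j _.
  rewrite [in RHS](sum_dotp_delta v) (linear_sum A) sum_lfunE.
  rewrite (linear_sum (@cl_vec R n)) mulr_sumr.
  by apply: eq_bigr => i _; rewrite (linearZ_LR A) scale_lfunE.
have sumY : \sum_i \sum_j e i * cl_vec (A (b i) (dotp v (b j) *: b j)) = - s.
  rewrite -sumrN; apply: eq_bigr => i _.
  rewrite alternating_antisym linearN mulrN opprK /=.
  rewrite [in RHS](sum_dotp_delta v) (linear_sum (A (b i))).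
  by rewrite (linear_sum (@cl_vec R n)) mulr_sumr.
have sumZ : \sum_i \sum_j e i * cl_vec (dotp v (A (b i) (b j)) *: b j) = s.
  apply: eq_bigr => i _.
  rewrite alternating_antisym [A (b i) v]sum_dotp_delta -sumrN.
  rewrite (linear_sum (@cl_vec R n)) mulr_sumr.
  by apply: eq_bigr => j _; rewrite A_skew scaleNr opprK.
under eq_bigr do rewrite -scaler_sumr big_split sumrB.
rewrite -scaler_sumr big_split sumrB /= sumX sumY sumZ opprK.
rewrite -(scale1r s) -!scalerDl !scalerA; congr (_ *: _); ring.
Qed.

Hypothesis A_morph : forall v w, A (A v w) = ((A v \o A w) - (A w \o A v))%VF.
Hypothesis A_perfect : forall v, exists w, v = \sum_i A (b i) (A (b i) w).

Lemma spin_family_bracket v w :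
  cl_bracket (spin (A v)) (spin (A w)) = spin (A (A v w)).
Proof. by rewrite spin_bracket // A_morph. Qed.

Definition spin_family : set (clifford R n) := range (fun v => spin (A v)).

Lemma is_subspace_spin_family : is_subspace spin_family.
Proof.
split; first by exists 0; rewrite ?linear0.
by move=> k _ _ [v _ <-] [w _ <-]; exists (k *: v + w); rewrite // !linearP.
Qed.

Lemma holonomy_g_three_form : holonomy_g three_form = spin_family.
Proof.
rewrite /holonomy_g; under eq_fun do rewrite interior_three_form.
apply: smallest_id; split; first exact: is_subspace_spin_family.
by move=> _ _ [v _ <-] [w _ <-]; exists (A v w); rewrite ?spin_family_bracket.
Qed.

(** A vector [sum_i A e_i (A e_i w)] is a sum of brackets in the Lie algebra
    that [A] represents, so under [A_perfect] nothing is lost in the derived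
    algebra. *)
Lemma holonomy_h_three_form : holonomy_h three_form = spin_family.
Proof.
rewrite /holonomy_h holonomy_g_three_form; apply/seteqP; split.
  apply: smallest_sub; first exact: is_subspace_spin_family.
  move=> _ [_ [v _ <-] [_ [w _ <-] <-]].
  by exists (A v w); rewrite ?spin_family_bracket.
move=> _ [v _ <-] C [[C0 CD] brC].
have [w ->] := A_perfect v.
rewrite (linear_sum A) (linear_sum (@spin R n)) /=.
elim/big_rec: _ => [|i x _ Cx]; first exact: C0.
rewrite -[spin _]scale1r; apply: CD => //; apply: brC.
by exists (spin (A (b i))); [exists (b i)|
   exists (spin (A (A (b i) w))); [exists (A (b i) w)|rewrite spin_family_bracket]].
Qed.

Lemma holonomy_three_form :
  [set F | exists2 a, holonomy_h three_form a & acts_as a F] = range A.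
Proof.
rewrite holonomy_h_three_form; apply/seteqP; split => [F [_ [v _ <-] aF]|_ [v _ <-]].
  exists v => //; apply/lfunP => w; apply: cl_vec_inj.
  by rewrite aF spin_bracket_vec.
by exists (spin (A v)) => [|w]; [exists v|rewrite spin_bracket_vec].
Qed.

End ThreeForm.

(** * The adjoint representation in an orthonormal frame *)

(** The centre is an ideal whose derived algebra is already zero. *)
Lemma semisimple_center0 (R : comNzRingType) (V : lmodType R)
    (br : {bilinear V -> V -> V}) :
  is_semisimple br -> forall x, (forall y, br y x = 0) -> x = 0.
Proof.
move=> ss x xZ; pose Z := [set z | forall y, br y z = 0].
suff ZE : Z = [set 0] by have : Z x by []; rewrite ZE.
apply: ss.
  split=> [|y z zZ t]; last by rewrite zZ linear0r.
  split=> [y|k z t zZ tZ y]; first by rewrite linear0r.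
  by rewrite linearPr zZ tZ scaler0 addr0.
exists 1%N; apply/seteqP; split => [|_ -> C [[]] //].
apply: smallest_sub; last by move=> _ [z zZ [t tZ <-]]; rewrite /= tZ.
by split=> // k _ _ -> ->; rewrite scaler0 addr0.
Qed.

Section Coordinates.
Variables (R : realType) (n : nat) (g : vectType R).
Variables (br : {bilinear g -> g -> g}) (ip : {dot g for idfun}).
Variable phi : {linear 'rV[R]_n -> g}.
Hypothesis phi_isom : forall v w, ip (phi v) (phi w) = dotp v w.
Hypothesis dim_g : \dim {:g} = n.

Let phi_inj : lker (linfun phi) == 0%VS.
Proof.
rewrite -subv0; apply/subvP => v; rewrite memv_ker lfunE /= memv0 => /eqP v0.
by apply/eqP/dotp_eq0; rewrite -phi_isom v0 linear0l.
Qed.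

Definition isometry_inv : 'Hom(g, 'rV[R]_n) := ((linfun phi)^-1)%VF.

Lemma isometryK : cancel phi isometry_inv.
Proof. by move=> v; have := lker0_lfunK phi_inj v; rewrite lfunE. Qed.

Lemma isometryKV : cancel isometry_inv phi.
Proof.
move=> x; rewrite -[LHS](lfunE phi) limg_lfunVK //.
suff -> : limg (linfun phi) = fullv by rewrite memvf.
apply/eqP; rewrite eqEdim subvf limg_dim_eq; last by rewrite (eqP phi_inj) capv0.
by rewrite dim_g dimvf dim_matrix mul1r leqnn.
Qed.

Definition coord_ad (v : 'rV[R]_n) : 'End('rV[R]_n) :=
  linfun (isometry_inv \o br (phi v) \o phi).

Lemma coord_adE v w : coord_ad v w = isometry_inv (br (phi v) (phi w)).
Proof. by rewrite lfunE. Qed.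

Lemma phi_coord_ad v w : phi (coord_ad v w) = br (phi v) (phi w).
Proof. by rewrite coord_adE isometryKV. Qed.

Lemma coord_ad_is_linear : linear coord_ad.
Proof.
move=> k v w; apply/lfunP => x; rewrite add_lfunE scale_lfunE !coord_adE.
by rewrite linearP linearPl linearP.
Qed.

HB.instance Definition _ :=
  GRing.isLinear.Build R 'rV[R]_n 'End('rV[R]_n) *:%R coord_ad coord_ad_is_linear.

Hypothesis br_lie : is_lie_bracket br.
Hypothesis br_inv : ad_invariant br ip.

Lemma skew_coord_ad v : skew (coord_ad v).
Proof.
move=> w x; apply/eqP; rewrite -addr_eq0 -!phi_isom !phi_coord_ad.
by apply/eqP/br_inv.
Qed.

Lemma coord_ad_alt v : coord_ad v v = 0.
Proof. by rewrite coord_adE br_lie.1 linear0. Qed.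

(** This is the Jacobi identity. *)
Lemma coord_ad_morph v w : coord_ad (coord_ad v w) =
  ((coord_ad v \o coord_ad w) - (coord_ad w \o coord_ad v))%VF.
Proof.
apply/lfunP => x; rewrite add_lfunE opp_lfunE !comp_lfunE !coord_adE !isometryKV.
have brC y z : br y z = - br z y.
  apply/eqP; rewrite -addr_eq0; have := br_lie.1 (y + z).
  by rewrite linearDl !linearDr !br_lie.1 add0r addr0 => /eqP.
rewrite -linearB; congr (isometry_inv _).
have /eqP := br_lie.2 (phi v) (phi w) (phi x).
rewrite [br (phi x) (phi v)]brC [br (phi x) (br _ _)]brC linearNr subr_eq0.
by move/eqP<-.
Qed.

Hypothesis br_ss : is_semisimple br.

(** A vector killed by all [ad e_i] is central, hence zero. *)
Lemma coord_ad_perfect v : exists w,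
  v = \sum_i coord_ad (delta_mx 0 i) (coord_ad (delta_mx 0 i) w).
Proof.
apply: (@skew_square_sum_onto _ _ _ (fun i => coord_ad (delta_mx 0 i))) => [i|w w0].
  exact: skew_coord_ad.
apply: (can_inj isometryK); rewrite linear0; apply: (semisimple_center0 br_ss) => y.
rewrite -[y]isometryKV -phi_coord_ad [isometry_inv y]row_sum_delta.
rewrite linear_sum sum_lfunE.
rewrite big1 ?linear0 // => i _.
by rewrite linearZ_LR scale_lfunE w0 scaler0.
Qed.

Lemma range_coord_ad : range coord_ad =
  [set F : 'End('rV[R]_n) | exists x : g, forall v, phi (F v) = br x (phi v)].
Proof.
apply/seteqP; split => [_ [v _ <-]|F [x Fx]].
  by exists (phi v) => w; rewrite phi_coord_ad.
exists (isometry_inv x) => //; apply/lfunP => v.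
by apply: (can_inj isometryK); rewrite phi_coord_ad isometryKV.
Qed.

End Coordinates.

Unset Implicit Arguments.

Theorem proposition4p4 (R : realType) (n : nat) (g : vectType R)
    (br : {bilinear g -> g -> g}) (ip : {dot g for idfun})
    (phi : {linear 'rV[R]_n -> g}) :
  \dim {:g} = n ->
  is_lie_bracket br -> is_compact_lie br -> is_semisimple br ->
  ad_invariant br ip ->
  (forall v w : 'rV[R]_n, ip (phi v) (phi w) = dotp v w) ->
  exists T : clifford R n, is_form 3 T /\
    [set F : 'End('rV[R]_n) | exists2 a, holonomy_h T a & acts_as a F] =
    [set F : 'End('rV[R]_n) | exists x : g, forall v, phi (F v) = br x (phi v)].
Proof.
move=> dim_g br_lie _ br_ss br_inv phi_isom; exists (three_form (coord_ad br phi)).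
have sk := skew_coord_ad phi_isom dim_g br_inv.
have alt := coord_ad_alt phi br_lie.
split; first exact: is_form3_three_form.
rewrite -(range_coord_ad br phi_isom dim_g); apply: holonomy_three_form => //.
  exact: coord_ad_morph phi_isom dim_g br_lie.
exact: coord_ad_perfect phi_isom dim_g br_inv br_ss.
Qed.
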